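(* Let $\{\mathbf{x}^k\}_{k\ge 0}$ and $\{\mathbf{y}^k\}_{k\ge 0}$ be the two sequences generated by the Bi-SG Algorithm (Version I or Version II). Then: (i) Let $1/2<\alpha\le1$. Any limit point of $\{\mathbf{y}^k\}$ belongs to $X^*$, i.e. is an optimal solution of the inner problem. In particular, $\lim_{k\to\infty}\mathrm{dist}(\mathbf{y}^k,X^* )=0$. (ii) Let $1/2<\alpha<1$, and for each $k\ge1$ let $k_{best}\in\arg\min\{\omega(\mathbf{y}^j):k\le j\le2k\}$. Any limit point of $\{\mathbf{y}^{k_{best}}\}_{k}$ belongs to $X'$, i.e. is an optimal solution of the outer problem. In particular, $\lim_{k\to\infty}\mathrm{dist}(\mathbf{y}^{k_{best}},X')=0$.
   Context: Problem. The inner problem is $\min_{\mathbf{x}\in\mathbb{R}^n}\{\varphi(\mathbf{x}):=f(\mathbf{x})+g(\mathbf{x})\}$, where $f:\mathbb{R}^n\to\mathbb{R}$ is convex and continuously differentiable with $L_f$-Lipschitz gradient ($L_f>0$), $g:\mathbb{R}^n\to(-\infty,\infty]$ is proper, lower semicontinuous and convex, and the set $X^*$ of minimizers of $\varphi$ is nonempty. The outer problem is $\min_{\mathbf{x}\in X^*}\omega(\mathbf{x})$, where $\omega:\mathbb{R}^n\to\mathbb{R}$ is convex and coercive ($\omega(\mathbf{x})\to\infty$ as $\|\mathbf{x}\|\to\infty$). $X'$ denotes the set of optimal solutions of the outer problem. The norm $\|\cdot\|$ is the Euclidean norm and $\mathrm{dist}$ is the distance to a set in this norm. Notation. For a smooth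 convex $s$, a proper lower semicontinuous convex $h$ and $t>0$: $\mathrm{prox}_{th}(\mathbf{x})=\arg\min_{\mathbf{u}}\{t h(\mathbf{u})+\frac12\|\mathbf{u}-\mathbf{x}\|^2\}$, $T_t^{s,h}(\mathbf{x})=\mathrm{prox}_{th}(\mathbf{x}-t\nabla s(\mathbf{x}))$, and the gradient mapping is $G_t^{s,h}(\mathbf{x})=\frac1t(\mathbf{x}-T_t^{s,h}(\mathbf{x}))$. A mapping $F:\mathbb{R}^n\to\mathbb{R}^n$ is quasi Lipschitz with constants $(d_1,d_2)$, $d_1,d_2\ge0$, if $\|F(\mathbf{x})\|\le\max\{d_1,d_2\|\mathbf{x}\|\}$ for all $\mathbf{x}$. Bi-SG Algorithm. Input $\alpha\in(1/2,1]$, $c>0$, and $\eta_k=c(k+1)^{-\alpha}$. Start from any $\mathbf{x}^0\in\mathbb{R}^n$. For $k=0,1,2,\dots$: $\mathbf{y}^k=T_{t_k}^{f,g}(\mathbf{x}^k)$ with $t_k=1/L_k$, then $\mathbf{x}^{k+1}=\mathbf{y}^k-\eta_k\Omega_k(\mathbf{y}^k)$, where: - Version I: $c\le1$; $\Omega_k=\Omega$ for all $k$, where $\Omega:\mathbb{R}^n\to\mathbb{R}^n$ satisfies $\Omega(\mathbf{x})\in\partial\omega(\mathbf{x})$ for all $\mathbf{x}$ and $\Omega$ is quasi Lipschitz (such a selection is assumed to exist). - Version II: it is assumed that $\omega=\sigma+\psi$ with $\sigma:\mathbb{R}^n\to\mathbb{R}$ convex, continuously differentiable with $L_\sigma$-Lipschitz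 gradient ($L_\sigma>0$) and $\psi:\mathbb{R}^n\to\mathbb{R}$ proper, lower semicontinuous and convex; $c\le\min\{1/L_\sigma,1\}$; $\Omega_k=G_{\eta_k}^{\sigma,\psi}$, i.e. $\mathbf{x}^{k+1}=\mathrm{prox}_{\eta_k\psi}(\mathbf{y}^k-\eta_k\nabla\sigma(\mathbf{y}^k))$. Step-sizes. Either constant, $L_k=L_f$ for all $k$; or backtracking with parameters $\gamma>0$, $\rho>1$: $L_{-1}=\gamma$ and $L_k=L_{k-1}\rho^{i_k}$, where $i_k$ is the smallest non-negative integer such that, with $t_k=1/L_k$, $f(T_{t_k}^{f,g}(\mathbf{x}^k))\le f(\mathbf{x}^k)+\langle\nabla f(\mathbf{x}^k),T_{t_k}^{f,g}(\mathbf{x}^k)-\mathbf{x}^k\rangle+\frac{L_k}{2}\|T_{t_k}^{f,g}(\mathbf{x}^k)-\mathbf{x}^k\|^2$. *)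

(* Defs.v *)
From HB Require Import structures.
From mathcomp Require Import all_boot all_order all_algebra.
From mathcomp Require Import all_classical all_reals all_analysis.

Set Implicit Arguments.
Unset Strict Implicit.
Unset Printing Implicit Defensive.

Import Order.TTheory GRing.Theory Num.Theory.
Import numFieldNormedType.Exports.

Local Open Scope classical_set_scope.
Local Open Scope ring_scope.

(* The space R^n is 'rV[R]_n.  Its library norm `|x| is the sup norm, so the
   Euclidean structure is defined here; the library topology on 'rV[R]_n
   (used for continuity, differentiability, semicontinuity and limit points)
   is the usual one. *)
Section Euclidean.
Context {R : realType} {n : nat}.
Implicit Types x y : 'rV[R]_n.

Definition inner x y : R := \sum_(i < n) x ord0 i * y ord0 i.

Definition enorm x : R := Num.sqrt (inner x x).

(* Extended-real valued: the distance to the empty set is +oo. *)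
Definition edistance x (A : set 'rV[R]_n) : \bar R :=
  ereal_inf [set (enorm (x - z))%:E | z in A].

Definition gradient (s : 'rV[R]_n -> R) x : 'rV[R]_n :=
  \row_(i < n) 'D_(delta_mx ord0 i) s x.

End Euclidean.

Definition argmin {R : realType} {T : Type} (A : set T) (F : T -> \bar R) :
    set T :=
  [set u | A u /\ forall v, A v -> (F u <= F v)%E].

Section ConvexAnalysis.
Context {R : realType} {n : nat}.
Local Notation V := 'rV[R]_n.

Definition smooth_convex (s : V -> R) (L : R) : Prop :=
  [/\ convex_function [set: convex_lmodType V] s,
      forall x, differentiable s x,
      continuous (gradient s) &
      forall x y, enorm (gradient s x - gradient s y) <= L * enorm (x - y)].

Definition proper (h : V -> \bar R) : Prop :=
  (forall x, h x != -oo%E) /\ (exists x, h x != +oo%E).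

(* For a function avoiding -oo, no undefined sum can occur, and 0 * +oo = 0. *)
Definition econvex (h : V -> \bar R) : Prop :=
  forall (x y : V) (t : R), 0 <= t <= 1 ->
    (h (t *: x + (1 - t) *: y)%R <= t%:E * h x + (1 - t)%:E * h y)%E.

Definition proper_lsc_convex (h : V -> \bar R) : Prop :=
  [/\ proper h, lower_semicontinuous h & econvex h].

Definition coercive (w : V -> R) : Prop :=
  forall M : R, exists r : R, forall x, r <= enorm x -> M <= w x.

Definition subdifferential (w : V -> R) (x : V) : set V :=
  [set v | forall z, w x + inner v (z - x) <= w z].

Definition quasi_lipschitz (F : V -> V) (d1 d2 : R) : Prop :=
  [/\ 0 <= d1, 0 <= d2 & forall x, enorm (F x) <= Num.max d1 (d2 * enorm x)].

(* The minimizer is unique when h is proper, lower semicontinuous and convex;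
   get would return an arbitrary point if there were none. *)
Definition prox (h : V -> \bar R) (x : V) : V :=
  get (argmin setT (fun u => (h u + (2^-1 * enorm (u - x) ^+ 2)%:E)%E)).

Definition prox_grad (s : V -> R) (h : V -> \bar R) (t : R) (x : V) : V :=
  prox (fun u => (t%:E * h u)%E) (x - t *: gradient s x).

Definition grad_mapping (s : V -> R) (h : V -> \bar R) (t : R) (x : V) : V :=
  t^-1 *: (x - prox_grad s h t x).

End ConvexAnalysis.

Section BiSG.
Context {R : realType} {n : nat}.
Local Notation V := 'rV[R]_n.

Definition inner_objective (f : V -> R) (g : V -> \bar R) (x : V) : \bar R :=
  ((f x)%:E + g x)%E.

Definition inner_solutions (f : V -> R) (g : V -> \bar R) : set V :=
  argmin setT (inner_objective f g).

Definition outer_solutions (f : V -> R) (g : V -> \bar R) (w : V -> R) :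
    set V :=
  argmin (inner_solutions f g) (fun x => (w x)%:E).

Definition eta (c alpha : R) (k : nat) : R := c * k.+1%:R `^ (- alpha).

Definition sufficient_decrease (f : V -> R) (g : V -> \bar R) (x : V) (l : R) :
    Prop :=
  let z := prox_grad f g l^-1 x in
  f z <= f x + inner (gradient f x) (z - x) + l / 2 * enorm (z - x) ^+ 2.

Definition constant_stepsize (Lf : R) (L : nat -> R) : Prop :=
  forall k, L k = Lf.

Definition backtracking_stepsize (f : V -> R) (g : V -> \bar R)
    (gamma rho : R) (x : nat -> V) (L : nat -> R) : Prop :=
  forall k,
    let Lprev := if k is k'.+1 then L k' else gamma in
    exists i : nat,
      [/\ L k = Lprev * rho ^+ i,
          sufficient_decrease f g (x k) (Lprev * rho ^+ i) &
          forall j : nat, (j < i)%N ->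
            ~ sufficient_decrease f g (x k) (Lprev * rho ^+ j)].

Definition stepsize_rule (f : V -> R) (g : V -> \bar R) (Lf : R)
    (x : nat -> V) (L : nat -> R) : Prop :=
  constant_stepsize Lf L \/
  exists gamma rho : R,
    [/\ 0 < gamma, 1 < rho & backtracking_stepsize f g gamma rho x L].

Definition version_I (w : V -> R) (c : R) (Om : nat -> V -> V) : Prop :=
  c <= 1 /\
  exists Omega : V -> V,
    [/\ forall x, subdifferential w x (Omega x),
        exists d1 d2 : R, quasi_lipschitz Omega d1 d2 &
        forall k, Om k = Omega].

Definition version_II (w : V -> R) (c alpha : R) (Om : nat -> V -> V) : Prop :=
  exists (sigma : V -> R) (psi : V -> \bar R) (Ls : R),
    [/\ 0 < Ls /\ smooth_convex sigma Ls,
        proper_lsc_convex psi,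
        forall x, (w x)%:E = ((sigma x)%:E + psi x)%E,
        c <= Num.min Ls^-1 1 &
        forall k, Om k = grad_mapping sigma psi (eta c alpha k)].

Definition bisg (f : V -> R) (g : V -> \bar R) (Lf : R) (w : V -> R)
    (c alpha : R) (x y : nat -> V) : Prop :=
  exists (L : nat -> R) (Om : nat -> V -> V),
    [/\ stepsize_rule f g Lf x L,
        version_I w c Om \/ version_II w c alpha Om,
        forall k, y k = prox_grad f g (L k)^-1 (x k) &
        forall k, x k.+1 = y k - eta c alpha k *: Om k (y k)].

End BiSG.

(* Main.v *)
Require Import Defs.
From HB Require Import structures.
From mathcomp Require Import all_boot all_order all_algebra.
From mathcomp Require Import all_classical all_reals all_analysis.
From mathcomp Require Import ring lra.

Set Implicit Arguments.
Unset Strict Implicit.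
Unset Printing Implicit Defensive.

Import Order.TTheory GRing.Theory Num.Theory.
Import numFieldNormedType.Exports.

Local Open Scope classical_set_scope.
Local Open Scope ring_scope.

(** Write X* for the inner solutions, phi = f + g and p k for the squared
    distance of y k to a point z of X*.

    Inner step. The prox-grad inequality [prox_grad_ineq] compares y k with an
    arbitrary point u: the excess phi (y k) - phi u is at most a multiple of
    |x k - u| ^ 2 - |y k - u| ^ 2. With u = z it shows that the inner step does
    not increase the distance to z and that the gap phi (y k) - phi z is
    controlled by the decrease of the squared distance. With u = y (k - 1) it
    shows that phi increases by at most a multiple of |x k - y (k - 1)| ^ 2.

    Outer step. In both versions, on bounded sets, the outer step moves by
    O(eta k) and satisfies [outer_descent]: 2 * eta k * (omega (y k) - omega z)
    is at most the decrease of the squared distance to z plus O(eta k ^ 2). For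
    Version I this is the subgradient inequality; for Version II it is the
    prox-grad inequality for sigma + psi, which bounds omega at the new point,
    followed by the Lipschitz continuity of omega on balls. Coercivity gives
    [controlled_growth]: the distance to z can grow only by summable relative
    amounts once it is large. As the eta k are square-summable
    ([sum_eta_sqr_bounded]), the iterates are bounded ([iterates_bounded]).

    Part (i). The gap is nonnegative and increases by at most O(eta k ^ 2) per
    step, so it converges; a positive limit would make p k decrease by a fixed
    amount at every step, up to summable errors, which is impossible for a
    nonnegative sequence ([vanishing_gap]). Lower semicontinuity of phi puts
    the cluster points into X*.

    Part (ii). Summing [outer_descent] over the window k, ..., 2k bounds
    (omega (y (kbest k)) - omega z) times the sum of the eta j by a constant.
    For alpha < 1 the sum of the eta j over the window tends to infinity
    ([sum_eta_window_unbounded]), so that the upper limit of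
    omega (y (kbest k)) is at most omega z for every z in X*. Lower
    semicontinuity of omega concludes.

    Distances. A bounded sequence is eventually in every neighbourhood of its
    set of cluster points, by compactness of balls ([edistance_cvg0]). *)

(** * Euclidean geometry of row vectors *)

Section EuclideanTheory.
Context {R : realType} {n : nat}.
Implicit Types (x y z u v : 'rV[R]_n) (a b : R).

Lemma innerC x y : inner x y = inner y x.
Proof. by apply: eq_bigr => i _; rewrite mulrC. Qed.

Lemma innerDl x y z : inner (x + y) z = inner x z + inner y z.
Proof. by rewrite -big_split; apply: eq_bigr => i _; rewrite mxE mulrDl. Qed.

Lemma innerZl a x y : inner (a *: x) y = a * inner x y.
Proof. by rewrite mulr_sumr; apply: eq_bigr => i _; rewrite mxE mulrA. Qed.

Lemma innerNl x y : inner (- x) y = - inner x y.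
Proof. by rewrite -scaleN1r innerZl mulN1r. Qed.

Lemma innerDr x y z : inner x (y + z) = inner x y + inner x z.
Proof. by rewrite innerC innerDl !(innerC _ x). Qed.

Lemma innerZr a x y : inner x (a *: y) = a * inner x y.
Proof. by rewrite innerC innerZl (innerC _ x). Qed.

Lemma innerNr x y : inner x (- y) = - inner x y.
Proof. by rewrite innerC innerNl (innerC _ x). Qed.

(** Bilinearity as one rewriting rule. The pairs inner x y and inner y x still
    have to be identified before ring or nra applies. *)
Definition innerE := (innerDl, innerDr, innerZl, innerZr, innerNl, innerNr).

Lemma inner_ge0 x : 0 <= inner x x.
Proof. by apply: sumr_ge0 => i _; rewrite -expr2 sqr_ge0. Qed.

Lemma enorm_ge0 x : 0 <= enorm x.
Proof. exact: sqrtr_ge0. Qed.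

Lemma enorm_sqr x : enorm x ^+ 2 = inner x x.
Proof. by rewrite sqr_sqrtr// inner_ge0. Qed.

Lemma enormN x : enorm (- x) = enorm x.
Proof. by rewrite /enorm !innerE opprK. Qed.

Lemma enormBC x y : enorm (x - y) = enorm (y - x).
Proof. by rewrite -enormN opprB. Qed.

Lemma enormZ a x : enorm (a *: x) = `|a| * enorm x.
Proof.
by rewrite /enorm !innerE mulrA -expr2 sqrtrM ?sqr_ge0// sqrtr_sqr.
Qed.

Lemma enorm_le x b : 0 <= b -> (enorm x <= b) = (inner x x <= b ^+ 2).
Proof.
by move=> b0; rewrite -enorm_sqr ler_pXn2r// nnegrE// enorm_ge0.
Qed.

Lemma coord_le_enorm x (i : 'I_n) : `|x ord0 i| <= enorm x.
Proof.
rewrite -sqrtr_sqr ler_sqrt ?inner_ge0// /inner (bigD1 i)//= -expr2 lerDl.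
by apply: sumr_ge0 => j _; rewrite -expr2 sqr_ge0.
Qed.

Lemma enorm_eq0 x : enorm x = 0 -> x = 0.
Proof.
move=> x0; apply/rowP => i; rewrite mxE; apply/eqP; rewrite -normr_le0 -x0.
exact: coord_le_enorm.
Qed.

Lemma inner0l x : inner 0 x = 0.
Proof. by rewrite -(scale0r x) innerZl mul0r. Qed.

Lemma inner0r x : inner x 0 = 0.
Proof. by rewrite innerC inner0l. Qed.

Lemma enorm0 : enorm (0 : 'rV[R]_n) = 0.
Proof. by rewrite /enorm inner0l sqrtr0. Qed.

Lemma cauchy_schwarz x y : inner x y <= enorm x * enorm y.
Proof.
have [/eqP|y0] := boolP (enorm y == 0).
  by move/enorm_eq0 => ->; rewrite inner0r enorm0 mulr0.
have [/eqP|x0] := boolP (enorm x == 0).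
  by move/enorm_eq0 => ->; rewrite inner0l enorm0 mul0r.
have xp : 0 < enorm x by rewrite lt_def x0 enorm_ge0.
have yp : 0 < enorm y by rewrite lt_def y0 enorm_ge0.
have := inner_ge0 (enorm y *: x - enorm x *: y).
rewrite !innerE (innerC y x) -!enorm_sqr => h.
rewrite -subr_ge0 -(pmulr_rge0 _ (mulr_gt0 xp yp)).
nra.
Qed.

Lemma enormD x y : enorm (x + y) <= enorm x + enorm y.
Proof.
rewrite enorm_le ?addr_ge0 ?enorm_ge0// !innerE (innerC y x) -!enorm_sqr.
have := cauchy_schwarz x y; nra.
Qed.

Lemma enormB x y : enorm x <= enorm y + enorm (x - y).
Proof. by rewrite -{1}(subrK y x) addrC enormD. Qed.

Lemma mx_norm_le_enorm x : `|x| <= enorm x.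
Proof.
rewrite [leLHS]/Num.norm/= mx_normrE; apply/bigmax_leP; split=> /=.
  exact: enorm_ge0.
by move=> [i j] _ /=; rewrite (ord1 i) coord_le_enorm.
Qed.

Lemma enorm_le_mx_norm x : enorm x <= n%:R * `|x|.
Proof.
rewrite enorm_le ?mulr_ge0//.
have cn i : `|x ord0 i| <= `|x|.
  rewrite [leRHS]/Num.norm/= mx_normrE.
  by apply: (le_bigmax _ (fun ij => `|x ij.1 ij.2|) (ord0, i)).
apply: (@le_trans _ _ (\sum_(i < n) `|x| ^+ 2)).
  apply: ler_sum => i _; rewrite -expr2 -real_normK ?num_real//.
  by rewrite ler_pXn2r// nnegrE.
rewrite sumr_const card_ord exprMn -[leLHS]mulr_natl ler_wpM2r ?sqr_ge0//.
by case: (n) => [|k]; rewrite ?expr0n// -natrX ler_nat leq_pmulr.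
Qed.

Lemma near_enorm_lt x (e : R) : 0 < e -> \forall y \near x, enorm (y - x) < e.
Proof.
move=> e0; apply/nbhs_ballP.
have d0 : 0 < e / n.+1%:R by rewrite divr_gt0.
exists (e / n.+1%:R) => //= y; rewrite -ball_normE/= => xy.
rewrite enormBC; apply: le_lt_trans (enorm_le_mx_norm _) _.
apply: (@le_lt_trans _ _ (n.+1%:R * `|x - y|)).
  by rewrite ler_wpM2r// ler_nat.
by rewrite mulrC -ltr_pdivlMr.
Qed.

Lemma closed_enorm_ball x (r : R) : closed [set v | enorm (v - x) <= r].
Proof.
move=> p cp /=; rewrite leNgt; apply/negP => rp.
have e0 : 0 < enorm (p - x) - r by rewrite subr_gt0.
have [v [/= vr vp]] := cp _ (near_enorm_lt p e0).
have := enormB (p - x) (v - x).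
rewrite (_ : p - x - _ = p - v); last by apply/rowP => i; rewrite !mxE; ring.
by rewrite (enormBC p v); lra.
Qed.

Lemma compact_enorm_ball x (r : R) : compact [set v | enorm (v - x) <= r].
Proof.
apply: bounded_closed_compact; last exact: closed_enorm_ball.
exists (enorm x + r); split; first exact: num_real.
move=> M rM v /= vr; apply: le_trans (mx_norm_le_enorm _) _.
by have := enormB v x; lra.
Qed.

(** The law of cosines, in the form used by prox inequalities. *)
Lemma three_point x u z :
  inner (x - u) (x - u) =
  inner (x - z) (x - z) + inner (z - u) (z - u) + 2 * inner (x - z) (z - u).
Proof. rewrite !innerE (innerC u x) (innerC z x) (innerC z u); ring. Qed.

End EuclideanTheory.

(** * Lower semicontinuity and compactness *)

Section Semicontinuity.
Context {R : realType} {T : topologicalType}.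
Implicit Types (h : T -> \bar R) (F : set_system T).

Lemma lsc_cluster h F p (a : R) : lower_semicontinuous h -> cluster F p ->
  (\forall v \near F, (h v <= a%:E)%E) -> (h p <= a%:E)%E.
Proof.
move=> hlsc Fp Fa; rewrite leNgt; apply/negP => /hlsc[V Vp Va].
by have [v [/= hv /Va]] := Fp _ _ Fa Vp; rewrite ltNge hv.
Qed.

(** Otherwise the filter restricted to the complement of U would have a cluster
    point in K, of which U is a neighbourhood. *)
Lemma compact_cluster_near F (K U : set T) : ProperFilter F -> compact K ->
  F K -> (forall p, cluster F p -> nbhs p U) -> F U.
Proof.
move=> FF cK FK nU; apply: contrapT => nFU.
pose G := within (~` U) F.
have GF : ProperFilter G.
  apply: Build_ProperFilter_ex => P GP; apply: contrapT => nP; apply: nFU.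
  apply: (@filterS _ F _ _ _ _ (GP : F (fun v => (~` U) v -> P v))) => v vP.
  by apply: contrapT => /vP Pv; apply: nP; exists v.
have FG : F `<=` G by move=> A FA; apply: filterS FA.
have [p [_ Gp]] := cK G GF (FG _ FK).
have Fp : cluster F p by move=> A B /FG; exact: Gp.
have GU : G (~` U) by apply: (@filterS _ F _ setT) => //; exact: filterT.
by have [v []] := Gp _ _ GU (nU _ Fp).
Qed.

Lemma ereal_le_lt_between (a b : \bar R) : (a < b)%E ->
  exists2 c : R, (a <= c%:E)%E & (c%:E < b)%E.
Proof.
case: a => [a| |]; [by exists a | by case: b |].
case: b => [b _| _|]//; last by exists 0; rewrite ?leNye ?ltry.
by exists (b - 1); rewrite ?leNye// lte_fin gtrBl.
Qed.

(** The sublevel sets of h at points of K form a filter base because the order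
    on the extended reals is total; any cluster point of it is a minimizer. *)
Lemma lsc_compact_min h (K : set T) : lower_semicontinuous h -> compact K ->
  K !=set0 -> exists2 p, K p & forall v, K v -> (h p <= h v)%E.
Proof.
move=> hlsc cK K0.
pose G := filter_from K (fun v => K `&` [set w | (h w <= h v)%E]).
have GF : ProperFilter G.
  apply: filter_from_proper; last by move=> v Kv; exists v; split => /=.
  apply: filter_from_filter => // v w Kv Kw.
  have [vw|wv] := leP (h v) (h w).
    exists v => // u [Ku uv]; split; split => //=.
    exact: le_trans vw.
  exists w => // u [Ku uw]; split; split => //=.
  exact: le_trans (ltW wv).
have [p [Kp Gp]] : K `&` cluster G !=set0.
  by apply: cK; have [k Kk] := K0; exists k => // v [].
exists p => // v Kv; rewrite leNgt; apply/negP.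
move=> /ereal_le_lt_between[c vc cp].
have : (h p <= c%:E)%E.
  apply: (lsc_cluster hlsc Gp).
  by exists v => // w [_ /= wv]; exact: le_trans vc.
by rewrite leNgt cp.
Qed.

Lemma lsc_addr h (s : T -> R) : lower_semicontinuous h ->
  lower_semicontinuous (EFin \o s) ->
  lower_semicontinuous (fun v => h v + (s v)%:E)%E.
Proof.
move=> hlsc slsc v a; rewrite -lteBlDr// -EFinB => hv.
have [c ac /hlsc[V Vv Vc]] : exists2 c : R, a - s v < c & (c%:E < h v)%E.
  case: (h v) hv => [b| |]//.
    rewrite lte_fin => ab; exists ((a - s v + b) / 2).
      by lra.
    by rewrite lte_fin; lra.
  by move=> _; exists (a - s v + 1); rewrite ?ltry ?ltrDl.
have [|W Wv Wc] := slsc v (a - c); first by rewrite /= lte_fin; lra.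
exists (V `&` W); first exact: filterI.
move=> w [/Vc + /Wc/=]; case: (h w) => [b| |]//.
  by rewrite -EFinD !lte_fin; lra.
by move=> _ _; rewrite addye ?ltry.
Qed.

Lemma lscZ h (t : R) : 0 < t -> lower_semicontinuous h ->
  lower_semicontinuous (fun v => t%:E * h v)%E.
Proof.
move=> t0 hlsc v a av.
have [|V Vv Va] := hlsc v (a / t).
  by rewrite EFinM lte_pdivrMr// muleC.
by exists V => // w /Va; rewrite EFinM lte_pdivrMr// muleC.
Qed.

Lemma continuous_lsc (s : T -> R) : continuous s ->
  lower_semicontinuous (EFin \o s).
Proof.
move=> cs v a; rewrite /= lte_fin => av.
have e0 : 0 < s v - a by rewrite subr_gt0.
exists [set w | `|s v - s w| < s v - a].
  by have /cvgrPdist_lt/(_ _ e0) := cs v.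
by move=> w /= /ltr_normlP[]; rewrite lte_fin; lra.
Qed.

End Semicontinuity.

(** A subgradient at v gives an affine minorant touching w at v. *)
Lemma subdifferential_lsc {R : realType} {n : nat} (w : 'rV[R]_n -> R) :
  (forall v, subdifferential w v !=set0) -> lower_semicontinuous (EFin \o w).
Proof.
move=> sw v a; rewrite /= lte_fin => av; have [g wg] := sw v.
have g1 : 0 < enorm g + 1 by rewrite ltr_wpDl ?enorm_ge0.
have d0 : 0 < (w v - a) / (enorm g + 1) by rewrite divr_gt0 ?subr_gt0.
exists [set z | enorm (z - v) < (w v - a) / (enorm g + 1)].
  exact: near_enorm_lt.
move=> z /=; rewrite ltr_pdivlMr// lte_fin => zv.
have := wg z; have := cauchy_schwarz (- g) (z - v); rewrite enormN innerNl.
have := enorm_ge0 (z - v); nra.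
Qed.

(** * Convex functions and proximal points *)

Section Prox.
Context {R : realType} {n : nat}.
Local Notation V := 'rV[R]_n.
Implicit Types (h : V -> \bar R) (x u v : V).

Lemma convex_functionP (w : V -> R) (x v : V) (t : R) :
  convex_function [set: convex_lmodType V] w -> 0 <= t <= 1 ->
  w (t *: x + (1 - t) *: v) <= t * w x + (1 - t) * w v.
Proof.
move=> wc /andP[t0 t1].
by have := wc (Itv01 t0 t1) x v; rewrite !in_setT => /(_ isT isT).
Qed.

Lemma econvex_le h x v a b (t : R) : econvex h -> h x = a%:E -> h v = b%:E ->
  0 <= t <= 1 -> (h (t *: x + (1 - t) *: v)%R <= (t * a + (1 - t) * b)%:E)%E.
Proof. by move=> hc hx hv /(hc x v); rewrite hx hv -!EFinM -EFinD. Qed.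

Lemma proper_lsc_convexZ h (t : R) : 0 < t -> proper_lsc_convex h ->
  proper_lsc_convex (fun v => t%:E * h v)%E.
Proof.
move=> t0 [[hNy [v hv]] hlsc hc]; split; last 2 first.
- exact: lscZ.
- move=> x u s /[dup] s01 /andP[s0 s1].
  have hs r z : 0 <= r -> (r%:E * h z != -oo)%E.
    rewrite le_eqVlt => /predU1P[<-|r0]; first by rewrite mul0e.
    by have := hNy z; case: (h z) => [b| |]// _; rewrite gt0_muley ?lte_fin.
  rewrite !(muleCA _ t%:E) -muleDr//; first by rewrite lee_pmul2l ?lte_fin ?hc.
  by rewrite ltninfty_adde_def// inE ltNye hs// subr_ge0.
split=> [u|].
  have := hNy u; case: (h u) => [b| |]// _.
  by rewrite gt0_muley ?lte_fin.
exists v; have := hNy v; move: hv; case: (h v) => [b| |]//.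
Qed.

(** A proper lower semicontinuous convex function is bounded below on a ball;
    convexity along rays from the centre turns this into a lower bound with
    linear growth. *)
Lemma convex_lsc_growth h x0 (a : R) : proper_lsc_convex h -> h x0 = a%:E ->
  exists2 c : R, 0 <= c & forall u, ((a - c - c * enorm (u - x0))%:E <= h u)%E.
Proof.
move=> [[hNy _] hlsc hc] hx0.
have [|p /= p1 pmin] := lsc_compact_min hlsc (@compact_enorm_ball _ _ x0 1).
  by exists x0; rewrite /= subrr enorm0.
have := pmin x0; rewrite /= subrr enorm0 hx0 => /(_ ler01) pa.
have [m hp] : exists m, h p = m%:E.
  by move: (hNy p) pa; case: (h p) => [m| |]// _ _; exists m.
rewrite hp lee_fin in pa.
exists (a - m); first by rewrite subr_ge0.
move=> u; have r0 := enorm_ge0 (u - x0); set r := enorm (u - x0) in r0 *.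
have [r1|r1] := leP r 1.
  by apply: le_trans (pmin u r1); rewrite hp lee_fin; nra.
move: (hNy u); case hu : (h u) => [b| |]// _; last by rewrite leey.
have rn0 : r != 0 by rewrite gt_eqF// (lt_trans ltr01).
have s01 : 0 <= r^-1 <= 1.
  by rewrite invr_ge0 r0 invf_le1 ?(ltW r1)// (lt_trans ltr01).
have := econvex_le hc hu hx0 s01.
set z := _ + _ => hz.
have zx : z - x0 = r^-1 *: (u - x0).
  by apply/rowP => i; rewrite !mxE; ring.
have z1 : enorm (z - x0) <= 1.
  by rewrite zx enormZ ger0_norm ?invr_ge0// mulVf.
have := le_trans (pmin z z1) hz; rewrite hp !lee_fin => mb.
have : r * m <= r * (r^-1 * b + (1 - r^-1) * a) by rewrite ler_wpM2l.
rewrite (_ : r * (_ + _) = b + (r - 1) * a); last by field.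
by nra.
Qed.

Lemma half_sqr_enorm_lsc x :
  lower_semicontinuous (EFin \o (fun u => 2^-1 * enorm (u - x) ^+ 2)).
Proof.
apply: subdifferential_lsc => v; exists (v - x) => z.
rewrite /= !enorm_sqr; have := three_point z x v.
rewrite (innerC (z - v) (v - x)); have := inner_ge0 (z - v); lra.
Qed.

(** The quadratic term dominates the linear lower bound on h, which confines the
    minimization to a ball, where compactness provides a minimizer. *)
Lemma prox_argmin h x : proper_lsc_convex h ->
  argmin setT (fun u => h u + (2^-1 * enorm (u - x) ^+ 2)%:E)%E (prox h x).
Proof.
move=> hplc; have [[hNy [x0 hx0]] hlsc _] := hplc; rewrite /prox.
pose F u := (h u + (2^-1 * enorm (u - x) ^+ 2)%:E)%E.
apply: (@getPex _ (argmin setT F)).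
have [a ha] : exists a, h x0 = a%:E.
  by move: (hNy x0) hx0; case: (h x0) => [a| |]// _ _; exists a.
have [c c0 growth] := convex_lsc_growth hplc ha.
have q0 := enorm_ge0 (x0 - x); set q := enorm (x0 - x) in q0.
pose rho := 2 * (c + q + 1).
have Flsc : lower_semicontinuous F.
  exact: (lsc_addr hlsc (@half_sqr_enorm_lsc x)).
have rho0 : 0 <= rho by rewrite /rho; lra.
have [|p _ pmin] := lsc_compact_min Flsc (@compact_enorm_ball _ _ x0 rho).
  by exists x0; rewrite /= subrr enorm0.
exists p; split=> // u _.
have [ur|ur] := leP (enorm (u - x0)) rho; first exact: pmin.
apply: (@le_trans _ _ (F x0)); first by apply: pmin; rewrite /= subrr enorm0.
rewrite /F ha -EFinD; move: (growth u) (hNy u).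
case: (h u) => [b| |]//; last first.
  by move=> _ _; rewrite addye// leey.
rewrite -EFinD !lee_fin -/q => + _.
have := enormB (u - x0) (u - x).
rewrite (_ : u - x0 - (u - x) = x - x0); last first.
  by apply/rowP => i; rewrite !mxE; ring.
rewrite (enormBC x) -/q; move: ur (enorm_ge0 (u - x)); rewrite /rho.
set r := enorm (u - x0); set s := enorm (u - x) => rr s0 rsq rb.
have : (r - q) ^+ 2 <= s ^+ 2 by rewrite ler_pXn2r// ?nnegrE; lra.
nra.
Qed.

(** First-order optimality: comparing the prox point with nearby points of the
    segment towards u, and letting the segment shrink, shows that x - prox h x
    is a subgradient of h at prox h x. *)
Lemma prox_subgradient h x : proper_lsc_convex h ->
  exists2 a, h (prox h x) = a%:E &
    forall u b, h u = b%:E -> a + inner (x - prox h x) (u - prox h x) <= b.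
Proof.
move=> hplc; have [[hNy [x0 hx0]] _ hc] := hplc.
have [_] := prox_argmin x hplc; set p := prox h x => pmin.
have [a ha] : exists a, h p = a%:E.
  move: (pmin x0 I) (hNy p) (hNy x0) hx0.
  by case: (h p) => [a| |]//; [exists a | case: (h x0)].
exists a => // u b hu; pose e := x - p; pose f := u - p.
rewrite -/e -/f; set d := inner e f; rewrite leNgt; apply/negP => bad.
set D := a + d - b; have D0 : 0 < D by rewrite subr_gt0.
set N := inner f f; have N0 : 0 <= N := inner_ge0 _.
have ND0 : 0 < N + D by rewrite ltr_wpDl.
(* The step s is small enough for its quadratic cost s * N / 2 to stay below
   the linear gain D. *)
pose s := D / (N + D).
have s0 : 0 < s by rewrite divr_gt0.
have s1 : s <= 1 by rewrite ler_pdivrMr// mul1r lerDr.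
have s01 : 0 <= s <= 1 by rewrite (ltW s0).
have sN : s * (N + D) = D by rewrite divfK// gt_eqF.
have hz := econvex_le hc hu ha s01; set z := _ + _ in hz.
have := le_trans (pmin z I) (leeD2r _ hz).
rewrite ha -!EFinD lee_fin !enorm_sqr.
have -> : z - x = s *: f - e by apply/rowP => i; rewrite !mxE; ring.
have -> : p - x = - e by rewrite opprB.
clearbody e f; rewrite !innerE (innerC f e) -/d -/N.
clearbody s; rewrite /D in D0 sN *; nra.
Qed.

End Prox.

(** * Smooth convex functions and the prox-grad step *)

Section ProxGrad.
Context {R : realType} {n : nat}.
Local Notation V := 'rV[R]_n.
Implicit Types (s : V -> R) (h : V -> \bar R) (x u v d : V).

Lemma derive_inner_gradient s x d : differentiable s x ->
  'D_d s x = inner (gradient s x) d.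
Proof.
move=> ds; rewrite deriveE// {1}(row_sum_delta d) linear_sum.
by apply: eq_bigr => i _; rewrite linearZ/= !mxE deriveE// mulrC.
Qed.

Lemma is_derive_line s x d (t : R) : differentiable s (t *: d + x) ->
  is_derive t 1 (fun t => s (t *: d + x)) (inner (gradient s (t *: d + x)) d).
Proof.
move=> ds; rewrite -derive_inner_gradient//.
have E : (fun h : R => h^-1 *: (s ((h *: 1 + t) *: d + x) - s (t *: d + x))) =
         (fun h : R => h^-1 *: (s (h *: d + (t *: d + x)) - s (t *: d + x))).
  by apply/funext => h; rewrite [h *: 1]mulr1 scalerDl addrA.
have D := diff_derivable (v := d) ds.
split; first by move: D; rewrite /derivable/= E.
by rewrite /derive/= E.
Qed.

(** By convexity, the difference quotients over segments contained in [x, u] are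
    at most s u - s x; so is their limit, the directional derivative. *)
Lemma gradient_ineq s (L : R) x u : smooth_convex s L ->
  s x + inner (gradient s x) (u - x) <= s u.
Proof.
move=> [sc ds _ _]; rewrite -derive_inner_gradient// leNgt; apply/negP => bad.
have D := diff_derivable (v := u - x) (ds x).
have lt0 : s u - s x < 'D_(u - x) s x by rewrite ltrBlDl.
have [e /= e0 He] := cvgr_gt _ D _ lt0.
pose t := Num.min (e / 2) 1.
have t0 : 0 < t by rewrite lt_min ltr01 divr_gt0.
have te : t < e by rewrite gt_min ltr_pdivrMr// ltr_pMr// ltr1n.
have t1 : t <= 1 by rewrite ge_min lexx orbT.
have := He t; rewrite /ball/= sub0r normrN gtr0_norm// => /(_ te).
rewrite gt_eqF// => /(_ isT).
have -> : t *: (u - x) + x = t *: u + (1 - t) *: x.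
  by apply/rowP => i; rewrite !mxE; ring.
have := @convex_functionP _ _ _ u x t sc; rewrite (ltW t0) t1 => /(_ isT).
rewrite /GRing.scale/= -(ltr_pM2l t0) mulrA divff ?gt_eqF// mul1r; nra.
Qed.

(** Along the segment from x to z, subtracting the quadratic upper model leaves
    a function whose derivative is nonpositive by Cauchy-Schwarz and the
    Lipschitz bound on the gradient. *)
Lemma descent_lemma s (L : R) x z : smooth_convex s L ->
  s z <= s x + inner (gradient s x) (z - x) + L / 2 * enorm (z - x) ^+ 2.
Proof.
move=> [_ ds _ sL]; set d := z - x; rewrite enorm_sqr.
set a := inner (gradient s x) d; set N := inner d d.
pose th (t : R) := s (t *: d + x).
pose phi : R -> R := th - (cst a * id + cst (L / 2 * N) * (id * id)).
pose dphi (t : R) := inner (gradient s (t *: d + x)) d - (a + L * N * t).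
have dp (t : R) : is_derive t 1 phi (dphi t).
  have dth : is_derive t 1 th (inner (gradient s (t *: d + x)) d).
    exact: is_derive_line.
  apply: is_derive_eq.
  by rewrite /dphi /GRing.scale/= !(mulr0, addr0, mulr1); field.
have [|c /andP[c0 c1]] := @MVT_segment R phi dphi 0 1 ler01 (fun t _ => dp t).
  by apply: derivable_within_continuous => t _; exact: ex_derive.
rewrite subr0 mulr1 /phi /dphi !fctE /th/= scale1r scale0r add0r subrK => E.
have : inner (gradient s (c *: d + x) - gradient s x) d <= L * N * c.
  apply: le_trans (cauchy_schwarz _ _) _.
  apply: (@le_trans _ _ (L * enorm (c *: d) * enorm d)).
    by rewrite ler_wpM2r ?enorm_ge0//; have := sL (c *: d + x) x; rewrite addrK.
  by rewrite enormZ ger0_norm// /N -enorm_sqr expr2; nra.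
by rewrite innerDl innerNl -/a; lra.
Qed.

Lemma sufficient_decrease_le s h (L l : R) x : smooth_convex s L -> L <= l ->
  sufficient_decrease s h x l.
Proof.
move=> sL Ll; rewrite /sufficient_decrease/=; set z := prox_grad _ _ _ _.
apply: le_trans (descent_lemma x z sL) _.
by rewrite lerD2l ler_wpM2r ?sqr_ge0// ler_wpM2r// invr_ge0.
Qed.

(** The sum of three inequalities: the sufficient decrease at z, the gradient
    inequality at x and the subgradient inequality that characterizes the prox.
    The law of cosines turns the resulting inner product into the difference of
    squared distances to u. *)
Lemma prox_grad_ineq s h (L l : R) x : smooth_convex s L ->
  proper_lsc_convex h -> 0 < l -> sufficient_decrease s h x l ->
  let z := prox_grad s h l^-1 x in
  exists2 a, h z = a%:E & forall u b, h u = b%:E ->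
    s z + a + l / 2 * (enorm (z - u) ^+ 2 - enorm (x - u) ^+ 2) <= s u + b.
Proof.
move=> sL hplc l0 dec z; rewrite /sufficient_decrease/= -/z in dec.
have li0 : 0 < l^-1 by rewrite invr_gt0.
have thplc := proper_lsc_convexZ li0 hplc.
have [a' za' sub] := prox_subgradient (x - l^-1 *: gradient s x) thplc.
rewrite -[prox _ _]/z in za' sub.
have [[hNy _] _ _] := hplc.
have [a za] : exists a, h z = a%:E.
  move: (hNy z) za'; case: (h z) => [a| |]//; first by exists a.
  by rewrite gt0_muley ?lte_fin.
exists a => // u b ub.
have a'E : a' = l^-1 * a by move: za'; rewrite za -EFinM => -[].
have := sub u (l^-1 * b); rewrite ub -EFinM => /(_ erefl).
rewrite -(ler_pM2l l0) mulrDr a'E !mulrA divff ?gt_eqF// !mul1r.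
have gx := gradient_ineq x u sL.
rewrite !enorm_sqr in dec *; rewrite (three_point x u z).
pose p := x - z; pose e := u - z; set gr := gradient s x in dec gx *.
have zx : z - x = - p by rewrite opprB.
have zu : z - u = - e by rewrite opprB.
have ux : u - x = e - p by rewrite opprB addrA subrK.
have xz : x - l^-1 *: gr - z = p - l^-1 *: gr by rewrite addrAC.
rewrite xz zu -/p -/e; rewrite zx in dec; rewrite ux in gx.
clearbody p e gr; rewrite !innerE in dec gx *.
rewrite mulrBr mulrA divff ?gt_eqF// mul1r; nra.
Qed.

End ProxGrad.

(** * Finite convex functions are Lipschitz on balls *)

Section ConvexLipschitz.
Context {R : realType} {n : nat}.
Local Notation V := 'rV[R]_n.
Variable w : V -> R.
Hypothesis w_convex : convex_function [set: convex_lmodType V] w.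

(** A point of a box lies on a segment joining two points whose next coordinate
    is extremal. Freeing the coordinates one at a time, from a single point to
    the whole box, thus propagates an upper bound. *)
Lemma convex_box_bounded (r : R) : 0 < r ->
  exists M, forall x : V, (forall i, `|x ord0 i| <= r) -> w x <= M.
Proof.
move=> r0.
suff H k (a : V) : exists M, forall x : V,
    (forall i : 'I_n, if (i < k)%N then is_true (`|x ord0 i| <= r)
                      else x ord0 i = a ord0 i) -> w x <= M.
  by have [M HM] := H n 0; exists M => x xr; apply: HM => i; rewrite ltn_ord.
elim: k a => [|k IH] a.
  by exists (w a) => x xa; rewrite (_ : x = a)//; apply/rowP => i; exact: xa.
have [kn|nk] := ltnP k n; last first.
  have [M HM] := IH a; exists M => x xa; apply: HM => i.
  by have := xa i; rewrite ltnS (leq_trans (ltnW (ltn_ord i)) nk)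
                           (leq_trans (ltn_ord i) nk).
pose k0 := Ordinal kn.
pose put (c : R) (x : V) : V := \row_i (if i == k0 then c else x ord0 i).
have [M1 HM1] := IH (put r a); have [M2 HM2] := IH (put (- r) a).
exists (Num.max M1 M2) => x xa.
have putP c (i : 'I_n) : if (i < k)%N then is_true (`|put c x ord0 i| <= r)
                else put c x ord0 i = put c a ord0 i.
  have := xa i; rewrite !mxE; have [->|ik] := eqVneq i k0.
    by rewrite /= ltnn.
  rewrite ltnS leq_eqVlt (_ : (i == k :> nat) = false) //.
  exact: (negbTE ik).
have w1 := HM1 _ (putP r); have w2 := HM2 _ (putP (- r)).
have /ler_normlP[xk1 xk2] : `|x ord0 k0| <= r.
  by have := xa k0; rewrite /= leqnn.
set t := (x ord0 k0 + r) / (2 * r).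
have r20 : 0 < 2 * r by rewrite mulr_gt0.
have t01 : 0 <= t <= 1.
  by rewrite divr_ge0 ?(ltW r20)//=; [rewrite ler_pdivrMr//; lra | lra].
have E : x = t *: put r x + (1 - t) *: put (- r) x.
  apply/rowP => i; rewrite !mxE; case: eqP => [->|_]; last by ring.
  by rewrite /t; field; rewrite gt_eqF.
have := convex_functionP (put r x) (put (- r) x) w_convex t01.
rewrite -E; case/andP: t01 => t0 t1 wt.
have m1 : M1 <= Num.max M1 M2 by rewrite le_max lexx.
have m2 : M2 <= Num.max M1 M2 by rewrite le_max lexx orbT.
nra.
Qed.

Lemma convex_ball_bounded (r : R) :
  exists M, forall x : V, enorm x <= r -> `|w x| <= M.
Proof.
have [|M HM] := @convex_box_bounded (Num.max r 1).
  by rewrite lt_max ltr01 orbT.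
have wM x : enorm x <= r -> w x <= M.
  move=> xr; apply: HM => i; apply: le_trans (coord_le_enorm _ _) _.
  by rewrite le_max xr.
exists (Num.max M (M - 2 * w 0)) => x xr.
have h2 : 0 <= (2^-1 : R) <= 1 by lra.
have := convex_functionP x (- x) w_convex h2.
rewrite (_ : _ + _ = 0); last by apply/rowP => i; rewrite !mxE; lra.
have := wM x xr; have := wM (- x); rewrite enormN => /(_ xr) ? ? ?.
by rewrite ler_norml lerNl !le_max; apply/andP; split; apply/orP;
  [right | left]; lra.
Qed.

(** Prolonging the segment from x to y by a unit length stays in a larger ball,
    where w is bounded; the slope over the prolongation dominates the slope
    between x and y. *)
Lemma convex_ball_lipschitz (r : R) : exists2 K, 0 <= K &
  forall x y : V, enorm x <= r -> enorm y <= r ->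
    w y - w x <= K * enorm (y - x).
Proof.
have [M HM] := convex_ball_bounded (r + 1).
exists (2 * `|M|); first by rewrite mulr_ge0.
move=> x y xr yr; have := enorm_ge0 (y - x).
rewrite le_eqVlt => /predU1P[/esym d0|d0].
  by rewrite d0; have /eqP := enorm_eq0 d0; rewrite subr_eq0 => /eqP->; lra.
set d := enorm (y - x) in d0 *.
pose z := y + d^-1 *: (y - x).
have dn0 : d != 0 by rewrite gt_eqF.
have d1n0 : 1 + d != 0 by rewrite gt_eqF// addr_gt0.
have zr : enorm z <= r + 1.
  apply: le_trans (enormD _ _) _; rewrite enormZ gtr0_norm ?invr_gt0//.
  by rewrite mulVf// lerD2r.
have := HM z zr; have := HM x (le_trans xr _); rewrite lerDl ler01 => /(_ isT).
have := ler_norm M; move: (`|M|) => N MN /ler_normlP[? ?] /ler_normlP[? ?].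
pose s := d / (1 + d).
have s0 : 0 <= s by rewrite divr_ge0// ltW// addr_gt0.
have sd : s <= d by rewrite ler_pdivrMr ?addr_gt0//; nra.
have s1 : s <= 1 by rewrite ler_pdivrMr ?addr_gt0//; lra.
have s01 : 0 <= s <= 1 by rewrite s0.
have := convex_functionP z x w_convex s01.
rewrite (_ : _ + _ = y); last first.
  by apply/rowP => i; rewrite !mxE /s; field; rewrite d1n0.
nra.
Qed.

End ConvexLipschitz.

(** * Step sizes *)

Section StepSizes.
Context {R : realType} {n : nat}.
Local Notation V := 'rV[R]_n.

(** By the descent lemma every trial value of at least Lf is accepted, so that
    backtracking never exceeds rho * Lf unless it starts above it. *)
Lemma stepsize_ruleP (f : V -> R) (g : V -> \bar R) (Lf : R) (x : nat -> V)
    (L : nat -> R) : 0 < Lf -> smooth_convex f Lf -> stepsize_rule f g Lf x L ->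
  exists M, forall k,
    [/\ 0 < L k, L k <= M & sufficient_decrease f g (x k) (L k)].
Proof.
move=> Lf0 fs [Lc|[gamma [rho [gamma0 rho1 Lb]]]].
  exists Lf => k; rewrite Lc; split=> //.
  exact: sufficient_decrease_le fs (lexx _).
have rho0 : 0 < rho by rewrite (lt_trans ltr01).
pose M := Num.max gamma (rho * Lf).
have step l i (x' : V) : 0 < l <= M ->
    (forall j, (j < i)%N -> ~ sufficient_decrease f g x' (l * rho ^+ j)) ->
    0 < l * rho ^+ i <= M.
  move=> /andP[l0 lM] fail; rewrite mulr_gt0 ?exprn_gt0//=.
  case: i fail => [|i] fail; first by rewrite expr0 mulr1.
  rewrite le_max exprSr mulrA mulrC ler_pM2l//; apply/orP; right.
  rewrite leNgt; apply/negP => /ltW Ll; apply: (fail i) => //.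
  exact: sufficient_decrease_le fs Ll.
have LM k : 0 < L k <= M.
  elim: k => [|k IH].
    have [i [-> _ fail]] := Lb 0%N; apply: step fail.
    by rewrite gamma0 le_max lexx.
  by have [i [-> _ fail]] := Lb k.+1; apply: step fail.
exists M => k; have /andP[L0 L1] := LM k; split=> //.
by have [i [E dec _]] := Lb k; rewrite E.
Qed.

Variables c alpha : R.
Hypotheses (c_gt0 : 0 < c) (alpha_gt : 2^-1 < alpha).

Lemma eta_gt0 k : 0 < Defs.eta c alpha k.
Proof. by rewrite mulr_gt0// powR_gt0. Qed.

Lemma eta_nonincreasing i j : (i <= j)%N ->
  Defs.eta c alpha j <= Defs.eta c alpha i.
Proof.
move=> ij; rewrite /Defs.eta ler_pM2l// !powRN lef_pV2 ?posrE ?powR_gt0//.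
rewrite ge0_ler_powR ?nnegrE ?ler_nat//.
by move: alpha_gt; lra.
Qed.

Lemma eta_le k : Defs.eta c alpha k <= c.
Proof.
apply: le_trans (eta_nonincreasing (leq0n k)) _.
by rewrite /Defs.eta powR1 mulr1.
Qed.

(** The mean value bound comparing a p-series with its telescoping majorant,
   obtained from 1 + t <= exp t and ln (1 + t) <= t. *)
Lemma powR_telescope (b m : R) : 0 < b -> 0 < m ->
  b * (m + 1) `^ (- (b + 1)) <= m `^ (- b) - (m + 1) `^ (- b).
Proof.
move=> b0 m0; have m10 : 0 < m + 1 by rewrite addr_gt0.
rewrite opprD powRD; last by rewrite (gt_eqF m10) implybT.
rewrite powR_inv1 ?(ltW m10)//.
have -> : m `^ (- b) = (m + 1) `^ (- b) * expR (b * (ln (m + 1) - ln m)).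
  rewrite /powR !gt_eqF// -expRD; congr expR; ring.
have lnm : (m + 1)^-1 <= ln (m + 1) - ln m.
  have := @le_ln1Dx R (- (m + 1)^-1).
  rewrite ltrN2 invf_lt1// ltrDr m0 => /(_ isT).
  have -> : 1 - (m + 1)^-1 = m / (m + 1) by field; rewrite gt_eqF.
  by rewrite ln_div ?posrE//; lra.
have := expR_ge1Dx (b * (ln (m + 1) - ln m)).
have := powR_gt0 (- b) m10; set X := _ `^ _; set E := expR _ => X0 E1.
have : b * (m + 1)^-1 <= E - 1 by nra.
rewrite mulrCA; nra.
Qed.

(** The exponent 2 * alpha exceeds 1 by b = 2 * alpha - 1, and the partial sums
    are bounded by those of the telescoping majorant. *)
Lemma sum_eta_sqr_bounded :
  exists S, forall N, \sum_(0 <= k < N) Defs.eta c alpha k ^+ 2 <= S.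
Proof.
pose b := 2 * alpha - 1; have b0 : 0 < b by rewrite /b; move: alpha_gt; lra.
exists (c ^+ 2 * (1 + b^-1)).
have etaE k : Defs.eta c alpha k ^+ 2 = c ^+ 2 * k.+1%:R `^ (- (b + 1)).
  rewrite /Defs.eta exprMn; congr (_ * _).
  rewrite -powR_mulrn ?powR_ge0// -powRrM.
  by congr (_ `^ _); rewrite /b; ring.
have H N : \sum_(0 <= k < N.+1) Defs.eta c alpha k ^+ 2 <=
    c ^+ 2 * (1 + b^-1 * (1 - N.+1%:R `^ (- b))).
  elim: N => [|N IH].
    by rewrite big_nat1 etaE !powR1 subrr mulr0 addr0.
  rewrite big_nat_recr//= etaE; apply: le_trans (lerD IH (lexx _)) _.
  rewrite -mulrDr ler_pM2l ?exprn_gt0// -addrA lerD2l.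
  have := @powR_telescope b N.+1%:R b0 (ltr0Sn _ _).
  rewrite natr1 -ler_pdivlMl// => H.
  apply: le_trans (lerD (lexx _) H) _; rewrite -mulrDr.
  by rewrite ler_wpM2l ?invr_ge0 ?(ltW b0)//; lra.
case=> [|N].
  by rewrite big_nil mulr_ge0 ?sqr_ge0// addr_ge0// invr_ge0 ltW.
apply: le_trans (H N) _; rewrite ler_pM2l ?exprn_gt0// lerD2l ler_piMr//.
by rewrite invr_ge0 ltW.
Qed.

(** Each of the k + 1 terms is at least c * (2 * (k + 1)) `^ (- alpha), so that
    the sum grows at least like (k + 1) `^ (1 - alpha). *)
Lemma sum_eta_window_unbounded (A : R) : alpha < 1 ->
  \forall k \near \oo, A <= \sum_(k <= j < (2 * k).+1) Defs.eta c alpha j.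
Proof.
move=> a1; pose b := 1 - alpha; have b0 : 0 < b by rewrite subr_gt0.
have a0 : 0 <= alpha by move: alpha_gt; lra.
pose B := (`|A| / (c * 2 `^ (- alpha))).
have cB : 0 < c * 2 `^ (- alpha) by rewrite mulr_gt0// powR_gt0.
have B0 : 0 <= B by rewrite divr_ge0// ltW.
near=> k.
have kB : B `^ b^-1 <= k%:R by near: k; exact: nbhs_infty_ger.
apply: (@le_trans _ _
    (\sum_(k <= j < (2 * k).+1) Defs.eta c alpha (2 * k))); last first.
  rewrite big_nat [leRHS]big_nat; apply: ler_sum => j /andP[_ jk].
  exact: eta_nonincreasing.
rewrite big_const_nat iter_addr_0 (_ : (2 * k).+1 - k = k.+1)%N; last first.
  by rewrite mul2n -addnn subSn ?leq_addr// addnK.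
apply: le_trans (ler_norm A) _.
have Bk : B <= k.+1%:R `^ b.
  have -> : B = (B `^ b^-1) `^ b by rewrite -powRrM mulVf ?powRr1// gt_eqF.
  rewrite ge0_ler_powR ?nnegrE ?powR_ge0 ?(ltW b0)//.
  by apply: le_trans kB _; rewrite ler_nat.
have : k.+1%:R `^ b = k.+1%:R `^ (- alpha) * k.+1%:R.
  rewrite -[X in _ * X](powRr1 (ler0n R k.+1)) -powRD ?pnatr_eq0 ?implybT//.
  by rewrite addrC.
move=> bE; rewrite -mulr_natr; apply: (@le_trans _ _
    (c * (2 * k.+1%:R) `^ (- alpha) * k.+1%:R)).
  rewrite powRM// -!mulrA -bE mulrA -ler_pdivrMl// mulrC.
  exact: Bk.
rewrite /Defs.eta ler_wpM2r// ler_pM2l// !powRN.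
rewrite lef_pV2 ?posrE ?powR_gt0 ?mulr_gt0//.
rewrite ge0_ler_powR ?nnegrE ?mulr_ge0// -natrM ler_nat.
by rewrite mulnS addnC addn2.
Unshelve. all: by end_near. Qed.

End StepSizes.

(** * Real sequences driven by square-summable step sizes *)

Section Sequences.
Context {R : realType}.
Variables (e : nat -> R) (S : R).
Hypothesis sum_sqr : forall N, \sum_(0 <= k < N) e k ^+ 2 <= S.

Let s N := \sum_(0 <= k < N) e k ^+ 2.

Let sS N : s N.+1 = s N + e N ^+ 2.
Proof. by rewrite /s big_nat_recr. Qed.

Let s_ge0 N : 0 <= s N.
Proof. by apply: sumr_ge0 => i _; rewrite sqr_ge0. Qed.

(** A discrete Gronwall bound: 1 + C * e k ^+ 2 <= expR (C * e k ^+ 2). *)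
Lemma max_growth_bounded (b : nat -> R) (B C : R) : 0 <= B -> 0 <= C ->
  (forall k, b k.+1 <= Num.max B ((1 + C * e k ^+ 2) * b k)) ->
  exists M, forall k, b k <= M.
Proof.
move=> B0 C0 bB; pose D := Num.max B (b 0%N).
have D0 : 0 <= D by rewrite le_max B0.
exists (D * expR (C * S)).
have H k : b k <= D * expR (C * s k).
  elim: k => [|k IH].
    by rewrite /s big_nil mulr0 expR0 mulr1 le_max lexx orbT.
  apply: le_trans (bB k) _; rewrite ge_max; apply/andP; split.
    apply: (@le_trans _ _ D); first by rewrite le_max lexx.
    by rewrite ler_peMr// -expR0 ler_expR mulr_ge0.
  have c0 : 0 <= C * e k ^+ 2 by rewrite mulr_ge0 ?sqr_ge0.
  apply: (@le_trans _ _ ((1 + C * e k ^+ 2) * (D * expR (C * s k)))).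
    by rewrite ler_wpM2l// addr_ge0.
  rewrite sS mulrDr expRD [leRHS]mulrA [leRHS]mulrC.
  by rewrite ler_wpM2r ?mulr_ge0 ?expR_ge0// expR_ge1Dx.
move=> k; apply: le_trans (H k) _.
by rewrite ler_wpM2l// ler_expR ler_wpM2l//; exact: sum_sqr.
Qed.

(** The sequence d converges, since d minus A times the partial sums of squares
    is nonincreasing and bounded below. A positive limit l would make the
    potential p lose an amount of order l / M at every late step, because the
    error K * e k is at most a fraction of that amount plus a multiple of the
    summable e k ^+ 2. *)
Lemma vanishing_gap (d p : nat -> R) (A K M : R) : 0 <= A -> 0 < M ->
  (forall k, 0 <= d k) -> (forall k, 0 <= p k) ->
  (forall k, d k.+1 <= d k + A * e k ^+ 2) ->
  (forall k, d k.+1 <= M * (p k - p k.+1 + K * e k)) ->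
  d @ \oo --> 0.
Proof.
move=> A0 M0 d0 p0 dA dM.
have scvg : cvgn s.
  apply: nondecreasing_is_cvgn.
    by apply/nondecreasing_seqP => k; rewrite sS lerDl sqr_ge0.
  by exists S => _ [k _ <-]; exact: sum_sqr.
have ucvg : cvgn (fun k => d k - A * s k).
  apply: nonincreasing_is_cvgn.
    by apply/nonincreasing_seqP => k; rewrite sS; have := dA k; lra.
  exists (- (A * S)) => _ [k _ <-].
  have : A * s k <= A * S by rewrite ler_wpM2l//; exact: sum_sqr.
  by have := d0 k; lra.
have dcvg : cvgn d.
  rewrite (_ : d = (fun k => d k - A * s k) + (fun k => A * s k)); last first.
    by apply/funext => k; rewrite fctE subrK.
  by apply: is_cvgD => //; exact: is_cvgMr.
have l0 : 0 <= limn d by apply: limr_ge => //; near=> k.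
suff : limn d = 0 by move=> <-.
apply/eqP; rewrite eq_le l0 andbT leNgt; apply/negP => lp.
set l := limn d in lp l0.
have [N _ HN] : \forall k \near \oo, l / 2 < d k.
  by apply: (cvgr_gt _ dcvg); rewrite -/l; lra.
(* The loss guaranteed at every step is 2 * a; half of it absorbs K * e k. *)
pose a := l / (4 * M); have a0 : 0 < a by rewrite divr_gt0// mulr_gt0.
pose C := K ^+ 2 / (4 * a).
have step k : (N <= k)%N -> p k.+1 <= p k - a + C * e k ^+ 2.
  move=> Nk; have dk := HN k.+1 (leqW Nk).
  have : 2 * a <= p k - p k.+1 + K * e k.
    rewrite -(ler_pM2l M0); apply: le_trans _ (dM k).
    rewrite (_ : M * (2 * a) = l / 2); first exact: ltW.
    by rewrite /a; field; rewrite gt_eqF.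
  have : K * e k <= a + C * e k ^+ 2.
    rewrite -subr_ge0 (_ : _ - _ = (K * e k - 2 * a) ^+ 2 / (4 * a)).
      by rewrite divr_ge0 ?sqr_ge0// mulr_ge0// ltW.
    by rewrite /C; field; rewrite gt_eqF.
  by lra.
have C0 : 0 <= C by rewrite divr_ge0 ?sqr_ge0// mulr_ge0// ltW.
have tele m : p (N + m)%N <= p N - m%:R * a + C * s (N + m)%N.
  elim: m => [|m IH]; first by rewrite addn0 mul0r subr0 lerDl mulr_ge0.
  rewrite addnS sS; apply: le_trans (step _ (leq_addr _ _)) _.
  by rewrite -[m.+1%:R]natr1; lra.
have [m Hm] : exists m : nat, (p N + C * S) / a < m%:R.
  have [m _ /(_ m)] := nbhs_infty_gtr ((p N + C * S) / a).
  by move=> /(_ (leqnn m)) ?; exists m.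
have := tele m; have := p0 (N + m)%N; move: Hm; rewrite ltr_pdivrMr//.
have : C * s (N + m)%N <= C * S by rewrite ler_wpM2l//; exact: sum_sqr.
lra.
Unshelve. all: by end_near. Qed.

(** If the best value of a window exceeded ws by epsilon, then summing the
    recursion over the window would bound 2 * epsilon times the sum of its step
    sizes, which is eventually as large as desired. *)
Lemma window_best (p w : nat -> R) (ws K P : R) (kbest : nat -> nat) :
  (forall k, 0 <= e k) -> 0 <= K ->
  (forall k, 0 <= p k) -> (forall k, p k <= P) ->
  (forall A : R, \forall k \near \oo, A <= \sum_(k <= j < (2 * k).+1) e j) ->
  (forall j, 2 * e j * (w j - ws) <= p j - p j.+1 + K * e j ^+ 2) ->
  (forall k, (1 <= k)%N ->
     forall j, (k <= j <= 2 * k)%N -> w (kbest k) <= w j) ->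
  forall eps, 0 < eps -> \forall k \near \oo, w (kbest k) <= ws + eps.
Proof.
move=> e0 K0 p0 pP window rec best eps eps0; near=> k.
have k1 : (1 <= k)%N by near: k; exact: nbhs_infty_ge.
have : (P + K * S + 1) / (2 * eps) <= \sum_(k <= j < (2 * k).+1) e j.
  by near: k; exact: window.
rewrite ler_pdivrMr ?mulr_gt0// leNgt => /negP bad.
rewrite leNgt; apply/negP => wk; apply: bad.
have kk : (k <= (2 * k).+1)%N by rewrite mul2n -addnn leqW// leq_addr.
have : \sum_(k <= j < (2 * k).+1) (e j * (2 * eps)) <=
       \sum_(k <= j < (2 * k).+1) (p j - p j.+1 + K * e j ^+ 2).
  rewrite big_nat [leRHS]big_nat; apply: ler_sum => j /andP[kj jk].
  apply: le_trans (rec j); have := best k k1 j; rewrite kj -ltnS jk => /(_ isT).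
  by have := e0 j; nra.
rewrite big_split/= -mulr_suml -mulr_sumr.
have -> : \sum_(k <= j < (2 * k).+1) (p j - p j.+1) = p k - p (2 * k).+1.
  rewrite -(opprB (p _.+1)) -(telescope_sumr _ kk) -sumrN.
  by apply: eq_bigr => j _; rewrite opprB.
have : K * \sum_(k <= j < (2 * k).+1) e j ^+ 2 <= K * S.
  rewrite ler_wpM2l//; apply: le_trans (sum_sqr (2 * k).+1).
  rewrite (big_cat_nat (leq0n k) kk)//= lerDr.
  by apply: sumr_ge0 => i _; rewrite sqr_ge0.
by have := pP k; have := p0 (2 * k).+1; lra.
Unshelve. all: by end_near. Qed.

End Sequences.

(** * Distance to the set of cluster points *)

Section Distance.
Context {R : realType} {n : nat}.
Implicit Types (v z : 'rV[R]_n) (A : set 'rV[R]_n).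

Lemma edistance_ge0 v A : (0 <= edistance v A)%E.
Proof.
by apply: le_ereal_inf_tmp => _ [z _ <-]; rewrite lee_fin enorm_ge0.
Qed.

Lemma edistance_le v z A : A z -> (edistance v A <= (enorm (v - z))%:E)%E.
Proof. by move=> Az; apply: ereal_inf_lbound; exists z. Qed.

(** By compactness, a bounded sequence is eventually in every neighbourhood of
    its cluster set. *)
Lemma edistance_cvg0 (v : nat -> 'rV[R]_n) A (r : R) :
  (forall k, enorm (v k) <= r) -> cluster (v @ \oo) `<=` A ->
  edistance (v k) A @[k --> \oo] --> 0%E.
Proof.
move=> vr vA.
have H (eps : R) : 0 < eps ->
    \forall k \near \oo, (edistance (v k) A < eps%:E)%E.
  move=> eps0.
  apply: (@compact_cluster_near _ (v @ \oo) _
    [set z | (edistance z A < eps%:E)%E] _ (@compact_enorm_ball _ _ 0 r)).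
    by exists 0%N => // k _ /=; rewrite subr0.
  move=> p /vA Ap; apply: (@filterS _ (nbhs p)) (near_enorm_lt p eps0) => z zp.
  by apply: le_lt_trans (edistance_le z Ap) _; rewrite lte_fin.
apply/fine_cvgP; split.
  apply: filterS (H 1 ltr01) => k k1; rewrite ge0_fin_numE ?edistance_ge0//.
  by apply: lt_trans k1 _; rewrite ltry.
apply/cvgrPdist_lt => eps eps0; apply: filterS (H eps eps0) => k keps.
rewrite sub0r normrN /= ger0_norm ?fine_ge0 ?edistance_ge0//.
rewrite -lte_fin fineK// ge0_fin_numE ?edistance_ge0//.
by apply: lt_trans keps _; rewrite ltry.
Qed.

End Distance.

(** * The outer step *)

Section OuterStep.
Context {R : realType} {n : nat}.
Local Notation V := 'rV[R]_n.
Variables (omega : V -> R) (c alpha : R) (Om : nat -> V -> V).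
Hypotheses (omega_convex : convex_function [set: convex_lmodType V] omega).
Hypotheses (omega_coercive : coercive omega).
Hypotheses (c_gt0 : 0 < c) (alpha_gt : 2^-1 < alpha).

Local Notation eta k := (Defs.eta c alpha k).
Local Notation outer k v := (v - eta k *: Om k v).

(** The first bound is for the steps on which omega is below omega z, which
    coercivity keeps in a ball; on the others the distance to z grows by a
    relative amount that is summable over k. *)
Definition controlled_growth :=
  forall z : V, exists B C : R, [/\ 0 <= B, 0 <= C & forall k v,
    enorm (outer k v - z) ^+ 2 <=
      Num.max B
        (enorm (v - z) ^+ 2 + C * eta k ^+ 2 * (1 + enorm (v - z) ^+ 2))].

(** The inequality of a subgradient step on bounded sets, with an error that is
    summable over k. *)
Definition outer_descent :=
  forall r : R, exists2 K : R, 0 <= K & forall k v,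
    enorm v <= r -> enorm (outer k v) <= r ->
    enorm (outer k v - v) <= K * eta k /\
    forall z, 2 * eta k * (omega v - omega z) <=
      enorm (v - z) ^+ 2 - enorm (outer k v - z) ^+ 2 + K * eta k ^+ 2.

Lemma enorm_sqrB_le (v z : V) (r : R) : 0 <= r -> enorm v <= r ->
  enorm (v - z) ^+ 2 <= (r + enorm z) ^+ 2.
Proof.
move=> r0 vr; have := enormD v (- z); rewrite enormN => vz.
rewrite ler_pXn2r// ?nnegrE ?enorm_ge0 ?addr_ge0 ?enorm_ge0//.
by apply: le_trans vz _; rewrite lerD2r.
Qed.

Lemma subgradient_step (v z : V) (k : nat) (t : R) :
  0 <= t -> subdifferential omega v (Om k v) ->
  2 * t * (omega v - omega z) <= enorm (v - z) ^+ 2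
    - enorm (v - t *: Om k v - z) ^+ 2 + t ^+ 2 * enorm (Om k v) ^+ 2.
Proof.
move=> t0 /(_ z); set q := Om k v; rewrite !enorm_sqr.
rewrite (_ : z - v = - (v - z)); last by rewrite opprB.
rewrite (_ : v - t *: q - z = (v - z) - t *: q); last by rewrite addrAC.
move: (v - z) => d; rewrite !innerE (innerC d q); nra.
Qed.

(** Where omega v >= omega z, a subgradient step of length t increases the
    squared distance to z by at most t ^ 2 * |Omega v| ^ 2, and the quasi
    Lipschitz bound makes this a multiple of t ^ 2 * (1 + |v - z| ^ 2). *)
Lemma version_I_properties : version_I omega c Om ->
  [/\ lower_semicontinuous (EFin \o omega), controlled_growth & outer_descent].
Proof.
move=> [c1 [W [sub [d1 [d2 [d10 d20 qL]]] OmE]]].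
have eta0 k := eta_gt0 alpha c_gt0 k.
have OmS k v : subdifferential omega v (Om k v) by rewrite OmE.
split.
- by apply: subdifferential_lsc => v; exists (W v).
- move=> z; have [r0 Hr0] := omega_coercive (omega z).
  pose r := Num.max r0 0; have r_ge0 : 0 <= r by rewrite le_max lexx orbT.
  pose D := Num.max d1 (d2 * r); have D0 : 0 <= D by rewrite le_max d10.
  exists ((r + D + enorm z) ^+ 2), (d1 ^+ 2 + 2 * d2 ^+ 2 * (1 + enorm z ^+ 2)).
  have d1s := sqr_ge0 d1; have d2s := sqr_ge0 d2.
  have zs := sqr_ge0 (enorm z).
  split=> [||k v]; first exact: sqr_ge0.
    by rewrite addr_ge0// mulr_ge0 ?addr_ge0// mulr_ge0.
  rewrite le_max; apply/orP.
  have e1 : eta k <= 1 by apply: le_trans (eta_le c_gt0 alpha_gt k) _.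
  have [vr|vr] := leP (enorm v) r.
    left; apply: enorm_sqrB_le; first exact: addr_ge0.
    apply: le_trans (enormD _ _) _; rewrite lerD// enormN enormZ.
    rewrite gtr0_norm// OmE -[leRHS]mul1r ler_pM ?enorm_ge0 ?(ltW (eta0 k))//.
    apply: le_trans (qL v) _; rewrite ge_max !le_max lexx/=.
    by rewrite ler_wpM2l// orbT.
  right; have /Hr0 zv : r0 <= enorm v.
    by apply: le_trans (ltW vr); rewrite le_max lexx.
  have := subgradient_step z (ltW (eta0 k)) (OmS k v).
  have : enorm (Om k v) ^+ 2 <= d1 ^+ 2 + d2 ^+ 2 * enorm v ^+ 2.
    rewrite OmE; have := qL v; have := enorm_ge0 (W v).
    have := mulr_ge0 d20 (enorm_ge0 v); rewrite -exprMn.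
    move: (d2 * enorm v) (enorm (W v)) => a b a0 b0.
    by rewrite le_max => /orP[]; nra.
  have : enorm v ^+ 2 <= 2 * enorm (v - z) ^+ 2 + 2 * enorm z ^+ 2.
    have := enormB v z; have := enorm_ge0 v.
    move: (enorm v) (enorm z) (enorm (v - z)) => a b d a0 h.
    have : a ^+ 2 <= (b + d) ^+ 2 by rewrite ler_pXn2r// nnegrE; lra.
    by have := sqr_ge0 (b - d); nra.
  have := eta0 k; set et := eta k => et0.
  have es := sqr_ge0 et; have vz := sqr_ge0 (enorm (v - z)).
  move: (enorm (v - z) ^+ 2) (enorm z ^+ 2) (enorm v ^+ 2) vz zs
    (enorm (Om k v) ^+ 2) (d1 ^+ 2) d1s (d2 ^+ 2) d2s
    => a b a' a0 b0 o x1 x10 x2 x20 ha ho main.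
  have ho' : o <= (x1 + 2 * x2 * (1 + b)) * (1 + a).
    apply: le_trans ho _; apply: (@le_trans _ _ (x1 + x2 * (2 * a + 2 * b))).
      by rewrite lerD2l ler_wpM2l.
    have := mulr_ge0 x10 a0; have := mulr_ge0 x20 (mulr_ge0 a0 b0); lra.
  have : et ^+ 2 * o <= et ^+ 2 * ((x1 + 2 * x2 * (1 + b)) * (1 + a)).
    by rewrite ler_wpM2l.
  have : 0 <= 2 * et * (omega v - omega z).
    by rewrite mulr_ge0 ?subr_ge0// mulr_ge0// ltW.
  by rewrite (mulrAC _ (et ^+ 2)) (mulrC _ (et ^+ 2)); lra.
- move=> r; pose D := Num.max d1 (d2 * r).
  have D0 : 0 <= D by rewrite le_max d10.
  exists (D + D ^+ 2); first by rewrite addr_ge0// sqr_ge0.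
  move=> k v vr _.
  have OD : enorm (Om k v) <= D.
    rewrite OmE; apply: le_trans (qL v) _; rewrite ge_max !le_max lexx/=.
    by rewrite ler_wpM2l// orbT.
  split=> [|z].
    rewrite addrAC subrr add0r enormN enormZ gtr0_norm// mulrC.
    rewrite ler_wpM2r ?(ltW (eta0 k))//; apply: le_trans OD _.
    by rewrite lerDl sqr_ge0.
  apply: le_trans (subgradient_step z (ltW (eta0 k)) (OmS k v)) _.
  rewrite lerD2l mulrC ler_wpM2r ?sqr_ge0//.
  apply: (@le_trans _ _ (D ^+ 2)); last by rewrite lerDr.
  by rewrite ler_pXn2r ?nnegrE ?enorm_ge0.
Qed.

(** As eta k <= 1 / Ls, the prox-grad inequality holds for sigma + psi and gives
    the descent inequality with omega at the new point, hence nonexpansiveness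
    towards z when omega is at least omega z there. Compared with v itself, it
    shows with the Lipschitz bound that the step has length O(eta k), so that
    moving from omega at the new point to omega v costs O(eta k ^ 2). *)
Lemma version_II_properties : version_II omega c alpha Om ->
  [/\ lower_semicontinuous (EFin \o omega), controlled_growth & outer_descent].
Proof.
move=> [sigma [psi [Ls [[Ls0 sigma_smooth] psi_plc omegaE cLs OmE]]]].
have eta0 k := eta_gt0 alpha c_gt0 k.
have psiE v : psi v = (omega v - sigma v)%:E.
  by rewrite EFinB omegaE (addeC (sigma v)%:E) addeK.
have main k v z : 2 * eta k * (omega (outer k v) - omega z) <=
    enorm (v - z) ^+ 2 - enorm (outer k v - z) ^+ 2.
  have e0 := eta0 k.
  have ei0 : 0 < (eta k)^-1 by rewrite invr_gt0.
  have LsE : Ls <= (eta k)^-1.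
    rewrite -[Ls]invrK lef_pV2 ?posrE ?invr_gt0//.
    apply: le_trans (eta_le c_gt0 alpha_gt k) _; apply: le_trans cLs _.
    by rewrite ge_min lexx.
  have [a] := prox_grad_ineq sigma_smooth psi_plc ei0
    (sufficient_decrease_le psi v sigma_smooth LsE).
  rewrite invrK.
  have -> : prox_grad sigma psi (eta k) v = outer k v.
    rewrite OmE /grad_mapping scalerA divff ?gt_eqF// scale1r.
    by rewrite opprB addrC subrK.
  rewrite psiE => -[<-] /(_ z _ (psiE z)).
  rewrite (addrC (sigma _)) subrK (addrC (sigma z)) subrK => H.
  rewrite -(ler_pM2l ei0) mulrA (mulrCA _ 2) mulVf ?gt_eqF// mulr1.
  by lra.
split.
- rewrite (_ : _ \o _ = fun v => (psi v + (sigma v)%:E)%E).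
    have [_ psi_lsc _] := psi_plc; have [_ ds _ _] := sigma_smooth.
    apply: lsc_addr => //; apply: continuous_lsc => v.
    exact: differentiable_continuous.
  by apply/funext => v /=; rewrite omegaE addeC.
- move=> z; have [r0 Hr0] := omega_coercive (omega z).
  pose r := Num.max r0 0; have r_ge0 : 0 <= r by rewrite le_max lexx orbT.
  exists ((r + enorm z) ^+ 2), 0; split=> [||k v]//; first exact: sqr_ge0.
  rewrite !mul0r addr0 le_max; apply/orP.
  have [vr|vr] := leP (enorm (outer k v)) r.
    by left; apply: enorm_sqrB_le.
  right; have /Hr0 zv : r0 <= enorm (outer k v).
    by apply: le_trans (ltW vr); rewrite le_max lexx.
  rewrite -subr_ge0; apply: le_trans (main k v z).
  by rewrite mulr_ge0 ?subr_ge0// mulr_ge0// ltW.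
- move=> r; have [K K0 lip] := convex_ball_lipschitz omega_convex r.
  exists (2 * K + 4 * K ^+ 2); first by rewrite addr_ge0 ?mulr_ge0 ?sqr_ge0.
  move=> k v vr or; have e0 := eta0 k.
  have lv := lip _ _ or vr; rewrite enormBC in lv.
  have d0 := enorm_ge0 (outer k v - v).
  have dK : enorm (outer k v - v) <= 2 * K * eta k.
    have := main k v v; rewrite subrr enorm0 expr0n/= sub0r.
    set d := enorm _ in lv d0 *; set et := eta k in e0 lv *.
    move: d0; rewrite le_eqVlt => /predU1P[<- _|d0 h].
      by rewrite mulr_ge0 ?mulr_ge0// ltW.
    rewrite -(ler_pM2l d0) -expr2.
    have : 2 * et * (omega v - omega (v - et *: Om k v)) <= 2 * et * (K * d).
      by rewrite ler_wpM2l// mulr_ge0// ltW.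
    lra.
  split=> [|z].
    apply: le_trans dK _; rewrite ler_wpM2r ?(ltW e0)// lerDl.
    by rewrite mulr_ge0 ?sqr_ge0.
  have := main k v z.
  have : 2 * eta k * (omega v - omega (outer k v)) <=
         2 * eta k * (K * (2 * K * eta k)).
    apply: ler_wpM2l; first by rewrite mulr_ge0// ltW.
    by apply: le_trans lv _; rewrite ler_wpM2l.
  have : 0 <= K * eta k ^+ 2 by rewrite mulr_ge0// sqr_ge0.
  nra.
Qed.

End OuterStep.

(** * Convergence of the iterates *)

Section Convergence.
Context {R : realType} {n : nat}.
Local Notation V := 'rV[R]_n.
Variables (f : V -> R) (g : V -> \bar R) (omega : V -> R) (Lf c alpha : R).
Variables (x y : nat -> V) (L : nat -> R) (M : R) (Om : nat -> V -> V).
Hypotheses (f_smooth : smooth_convex f Lf) (g_plc : proper_lsc_convex g).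
Hypothesis inner_nonempty : inner_solutions f g !=set0.
Hypotheses (c_gt0 : 0 < c) (alpha_gt : 2^-1 < alpha).
Hypothesis L_ok : forall k,
  [/\ 0 < L k, L k <= M & sufficient_decrease f g (x k) (L k)].
Hypothesis yE : forall k, y k = prox_grad f g (L k)^-1 (x k).
Hypothesis xE : forall k, x k.+1 = y k - Defs.eta c alpha k *: Om k (y k).
Hypotheses (omega_lsc : lower_semicontinuous (EFin \o omega))
  (Om_growth : controlled_growth c alpha Om)
  (Om_descent : outer_descent omega c alpha Om).

Local Notation eta k := (Defs.eta c alpha k).
Let gy k := fine (g (y k)).
Let phi k := f (y k) + gy k.

Let M_gt0 : 0 < M.
Proof. by have [L0 LM _] := L_ok 0; exact: lt_le_trans LM. Qed.

Let eta_pos k : 0 < eta k := eta_gt0 alpha c_gt0 k.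

Lemma inner_step k :
  g (y k) = (gy k)%:E /\ forall u b, g u = b%:E ->
    phi k + L k / 2 * (enorm (y k - u) ^+ 2 - enorm (x k - u) ^+ 2) <= f u + b.
Proof.
have [L0 _ dec] := L_ok k.
have [a + H] := prox_grad_ineq f_smooth g_plc L0 dec.
by rewrite -yE in H * => ga; rewrite /phi /gy ga.
Qed.

Lemma inner_solution_value z : inner_solutions f g z ->
  exists2 b, g z = b%:E & forall k, f z + b <= phi k.
Proof.
move=> [_ zmin]; have [gy0 _] := inner_step 0.
have [[gNy _] _ _] := g_plc.
have [b gz] : exists b, g z = b%:E.
  move: (zmin (y 0%N) I) (gNy z); rewrite /inner_objective gy0.
  by case: (g z) => [b| |]//; exists b.
exists b => // k; have [gyk _] := inner_step k.
by have := zmin (y k) I; rewrite /inner_objective gz gyk -!EFinD lee_fin.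
Qed.

Lemma inner_gap_le z b k : inner_solutions f g z -> g z = b%:E ->
  phi k - (f z + b) <= M / 2 * (enorm (x k - z) ^+ 2 - enorm (y k - z) ^+ 2).
Proof.
move=> zX gz; have [b' gz' min_phi] := inner_solution_value zX.
have bE : b' = b by move: gz'; rewrite gz => -[].
have [L0 LM _] := L_ok k; have [_ /(_ z b gz)] := inner_step k.
have := min_phi k; rewrite bE.
move: (enorm (x k - z) ^+ 2) (enorm (y k - z) ^+ 2) => X Y gap0 gapL.
have lXY : phi k - (f z + b) <= L k / 2 * (X - Y) by lra.
apply: le_trans lXY _; rewrite ler_wpM2r//; last by rewrite ler_wpM2r.
by rewrite -(pmulr_rge0 _ (divr_gt0 L0 (ltr0Sn R 1))); lra.
Qed.

Lemma inner_step_fejer z k : inner_solutions f g z ->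
  enorm (y k - z) ^+ 2 <= enorm (x k - z) ^+ 2.
Proof.
move=> zX; have [b gz min_phi] := inner_solution_value zX.
have := inner_gap_le k zX gz; have := min_phi k => p0 gap.
have : 0 <= M / 2 * (enorm (x k - z) ^+ 2 - enorm (y k - z) ^+ 2) by lra.
by rewrite pmulr_rge0 ?subr_ge0// divr_gt0.
Qed.

(** The inner step does not increase the distance to a solution z and the outer
    step has controlled growth, so that the discrete Gronwall bound applies to
    1 + |x k - z| ^ 2. *)
Lemma iterates_bounded : exists2 r, 0 <= r &
  forall k, enorm (x k) <= r /\ enorm (y k) <= r.
Proof.
have [z zX] := inner_nonempty; have [B [C [B0 C0 growth]]] := Om_growth z.
have [S HS] := sum_eta_sqr_bounded c_gt0 alpha_gt.
have [k|N HN] := max_growth_bounded HS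
    (b := fun k => 1 + enorm (x k - z) ^+ 2) (addr_ge0 ler01 B0) C0.
  have := growth k (y k); rewrite -xE; have := inner_step_fejer k zX.
  have : 0 <= C * eta k ^+ 2 by rewrite mulr_ge0// sqr_ge0.
  rewrite !le_max => ce0 fejer /orP[h|h]; apply/orP; [left|right]; first by lra.
  nra.
have bounded v : 1 + enorm (v - z) ^+ 2 <= N -> enorm v <= enorm z + N.
  by have := enormB v z; nra.
exists (enorm z + N).
  rewrite addr_ge0 ?enorm_ge0//; have := HN 0%N.
  by have := sqr_ge0 (enorm (x 0%N - z)); lra.
move=> k; split; apply: bounded => //.
by apply: le_trans (HN k); rewrite lerD2l inner_step_fejer.
Qed.

(** Comparing the prox-grad step at x k.+1 with the point y k shows that the
    inner objective increases by O(eta k ^+ 2); comparing it with a solution z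
    bounds the gap by the decrease of the squared distance to z, up to
    O(eta k). *)
Lemma inner_gap_cvg0 z b : inner_solutions f g z -> g z = b%:E ->
  (fun k => phi k - (f z + b)) @ \oo --> 0.
Proof.
move=> zX gz; have [S HS] := sum_eta_sqr_bounded c_gt0 alpha_gt.
have [r r0 xyr] := iterates_bounded; have [K K0 HK] := Om_descent r.
have [b' gz' min_phi] := inner_solution_value zX.
have bE : b' = b by move: gz'; rewrite gz => -[].
rewrite {}bE in min_phi.
have move_le k : enorm (x k.+1 - y k) <= K * eta k.
  have [_ yr] := xyr k; have [xr _] := xyr k.+1; rewrite xE in xr *.
  by have [] := HK k _ yr xr.
pose W := 2 * (r + enorm z).
apply: (@vanishing_gap _ (fun k => eta k) S HS _ (fun k => enorm (y k - z) ^+ 2)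
    (M / 2 * K ^+ 2) (K * W) (M / 2)).
- by rewrite mulr_ge0 ?sqr_ge0// divr_ge0// ltW.
- by rewrite divr_gt0.
- by move=> k; rewrite subr_ge0.
- by move=> k; rewrite sqr_ge0.
- move=> k; have [gyk _] := inner_step k; rewrite -[_ * K ^+ 2 * _]mulrA.
  have [L0 LM _] := L_ok k.+1; have [_ /(_ _ _ gyk)] := inner_step k.+1.
  rewrite -/(phi k); set d := enorm (y k.+1 - y k) ^+ 2.
  have : 0 <= d := sqr_ge0 _; move: d => d d0.
  have : enorm (x k.+1 - y k) ^+ 2 <= K ^+ 2 * eta k ^+ 2.
    rewrite -exprMn ler_pXn2r ?nnegrE ?enorm_ge0//.
    by rewrite mulr_ge0// ltW.
  have := sqr_ge0 (enorm (x k.+1 - y k)).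
  move: (enorm _ ^+ 2) (K ^+ 2 * _) => e w e0 ew H.
  have : L k.+1 / 2 * e <= M / 2 * w.
    by rewrite ler_pM ?divr_ge0 ?(ltW L0)// ler_wpM2r.
  have : 0 <= L k.+1 / 2 * d by rewrite mulr_ge0// divr_ge0// ltW.
  by lra.
move=> k; apply: le_trans (inner_gap_le k.+1 zX gz) _.
rewrite ler_pM2l ?divr_gt0//.
have xz := enormB (x k.+1 - z) (y k - z).
rewrite (_ : x k.+1 - z - _ = x k.+1 - y k) in xz; last first.
  by rewrite opprB addrA subrK.
have x0 := enorm_ge0 (x k.+1 - z); have y0 := enorm_ge0 (y k - z).
have [xr _] := xyr k.+1; have [_ yr] := xyr k.
have := enormD (x k.+1) (- z); have := enormD (y k) (- z); rewrite enormN.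
have := move_le k; have := enorm_ge0 (x k.+1 - y k).
rewrite /W mulrAC.
move: (enorm (x k.+1 - z)) (enorm (y k - z)) (enorm (x k.+1 - y k)) xz x0 y0
  => X Y t XYt X0 Y0 t0 tK Yr Xr.
have : X ^+ 2 - Y ^+ 2 <= t * (X + Y).
  by rewrite subr_sqr ler_wpM2r ?addr_ge0//; lra.
have : t * (X + Y) <= (K * eta k) * (2 * (r + enorm z)).
  by rewrite ler_pM ?addr_ge0//; lra.
by rewrite (mulrAC K); lra.
Qed.

Lemma inner_objective_lsc : lower_semicontinuous (inner_objective f g).
Proof.
have [_ g_lsc _] := g_plc; have [_ df _ _] := f_smooth.
rewrite (_ : inner_objective f g = fun v => (g v + (f v)%:E)%E); last first.
  by apply/funext => v; rewrite /inner_objective addeC.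
apply: lsc_addr => //; apply: continuous_lsc => v.
exact: differentiable_continuous.
Qed.

Lemma cluster_inner_solution : cluster (y @ \oo) `<=` inner_solutions f g.
Proof.
move=> p py; have [z zX] := inner_nonempty.
have [b gz min_phi] := inner_solution_value zX.
split=> // v _; apply: le_trans (zX.2 v I).
rewrite [leRHS]/inner_objective gz -EFinD; apply/lee_addgt0Pr => eps eps0.
rewrite -EFinD; apply: (lsc_cluster inner_objective_lsc py).
have /cvgrPdist_lt/(_ eps eps0) := inner_gap_cvg0 zX gz.
apply: filterS => k; rewrite sub0r normrN ger0_norm ?subr_ge0// => kz.
have [gyk _] := inner_step k.
by rewrite /= /inner_objective gyk -EFinD lee_fin -/(phi k); lra.
Qed.

(** The indices kbest k tend to infinity, so that p is a cluster point of y and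
    thus an inner solution; along them omega is eventually below omega z + eps
    for every inner solution z, and lower semicontinuity passes this to p. *)
Lemma cluster_outer_solution (kbest : nat -> nat) : alpha < 1 ->
  (forall k : nat, (1 <= k)%N ->
     argmin [set j : nat | (k <= j <= 2 * k)%N]
            (fun j => (omega (y j))%:E) (kbest k)) ->
  cluster ((fun k => y (kbest k)) @ \oo) `<=` outer_solutions f g omega.
Proof.
move=> alpha_lt1 best p py.
have pX : inner_solutions f g p.
  apply: cluster_inner_solution => A B [N _ NA] Bp; apply: py => //.
  exists N.+1 => // k /= Nk; apply: NA => /=.
  have [/andP[kk _] _] := best k (leq_ltn_trans (leq0n N) Nk).
  exact: leq_trans (ltnW Nk) kk.
split=> // z zX; rewrite lee_fin; apply/ler_addgt0Pr => eps eps0.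
rewrite -lee_fin; apply: (lsc_cluster omega_lsc py).
have [S HS] := sum_eta_sqr_bounded c_gt0 alpha_gt.
have [r r0 xyr] := iterates_bounded; have [K K0 HK] := Om_descent r.
apply: (@window_best _ (fun k => eta k) S HS (fun k => enorm (y k - z) ^+ 2)
  (fun k => omega (y k)) (omega z) K ((r + enorm z) ^+ 2)) => //.
- by move=> k; exact: ltW.
- by move=> k; rewrite sqr_ge0.
- by move=> k; apply: enorm_sqrB_le => //; have [] := xyr k.
- by move=> A; exact: sum_eta_window_unbounded.
- move=> k; have [_ yr] := xyr k; have [xr _] := xyr k.+1.
  have fejer := inner_step_fejer k.+1 zX; rewrite xE in xr fejer.
  by have [_ /(_ z)] := HK k _ yr xr; lra.
by move=> k k1 j kj; have [_ /(_ j kj)] := best k k1; rewrite lee_fin.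
Qed.

End Convergence.

Theorem proposition6 (R : realType) (n : nat)
    (f : 'rV[R]_n -> R) (g : 'rV[R]_n -> \bar R) (Lf : R)
    (omega : 'rV[R]_n -> R) (c alpha : R) (x y : nat -> 'rV[R]_n)
    (Lf_gt0 : 0 < Lf)
    (f_smooth : smooth_convex f Lf)
    (g_plc : proper_lsc_convex g)
    (inner_nonempty : inner_solutions f g !=set0)
    (omega_convex : convex_function [set: convex_lmodType 'rV[R]_n] omega)
    (omega_coercive : coercive omega)
    (alpha_gt : 2^-1 < alpha) (alpha_le1 : alpha <= 1)
    (c_gt0 : 0 < c)
    (xy_bisg : bisg f g Lf omega c alpha x y) :
  (cluster (y @ \oo) `<=` inner_solutions f g /\
   edistance (y k) (inner_solutions f g) @[k --> \oo] --> 0%E) /\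
  (alpha < 1 ->
   forall kbest : nat -> nat,
     (forall k : nat, (1 <= k)%N ->
        argmin [set j : nat | (k <= j <= 2 * k)%N]
               (fun j => (omega (y j))%:E) (kbest k)) ->
     cluster ((fun k => y (kbest k)) @ \oo) `<=` outer_solutions f g omega /\
     edistance (y (kbest k)) (outer_solutions f g omega) @[k --> \oo]
       --> 0%E).
Proof.
have [L [Om [rule version yE xE]]] := xy_bisg.
have [M L_ok] := stepsize_ruleP Lf_gt0 f_smooth rule.
have [omega_lsc growth descent] : [/\ lower_semicontinuous (EFin \o omega),
    controlled_growth c alpha Om & outer_descent omega c alpha Om].
  case: version; first exact: version_I_properties.
  exact: version_II_properties.
have [r _ xyr] := iterates_bounded f_smooth g_plc inner_nonempty c_gt0 alpha_gt
  L_ok yE xE growth.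
have inner_cluster := cluster_inner_solution f_smooth g_plc inner_nonempty c_gt0
  alpha_gt L_ok yE xE growth descent.
split.
  by split=> //; apply: (edistance_cvg0 (r := r)) => // k; have [] := xyr k.
move=> alpha_lt1 kbest best.
have outer_cluster := cluster_outer_solution f_smooth g_plc inner_nonempty c_gt0
  alpha_gt L_ok yE xE omega_lsc growth descent alpha_lt1 best.
split=> //; apply: (edistance_cvg0 (r := r)) => // k.
by have [] := xyr (kbest k).
Qed.
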